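(* Let $\Gamma$ be a tournament limit represented by a tournament kernel $W$. The following are equivalent: (i) $\Gamma$ is transitive; (ii) $W$ is transitive; (iii) the random infinite tournament $G(\infty,W)$ is almost surely transitive; (iv) for each $n\ge1$, the random tournament $G(n,W)$ is almost surely transitive.
   Context: A tournament kernel on $(\mathcal S,\mu)$ is a measurable $W:\mathcal S^2\to[0,1]$ with $W(x,y)+W(y,x)=1$ a.e.; it is transitive if $W(x,y)>0$ and $W(y,z)>0$ imply $W(x,z)=1$ for $\mu^3$-a.e. $(x,y,z)$. Tournament limits are limits of sequences of finite tournaments with convergent homomorphism densities and are determined by the induced densities $t_{\mathrm{ind}}(F,\Gamma)$ over finite tournaments $F$; $W$ represents $\Gamma$ if $t_{\mathrm{ind}}(F,\Gamma)=\int\prod_{(i,j)\in E(F)}W(x_i,x_j)\prod d\mu(x_i)$ for all finite tournaments $F$. For $r\in[0,1]$, $r\Gamma\oplus(1-r)\Gamma$ is the tournament limit with $t_{\mathrm{ind}}(F,\cdot)=\sum r^{v(F_1)}(1-r)^{v(F_2)}t_{\mathrm{ind}}(F_1,\Gamma)t_{\mathrm{ind}}(F_2,\Gamma)$, summing over ordered partitions of $V(F)$ into possibly empty induced subtournaments $F_1,F_2$ with all edges between them from $F_1$ to $F_2$ ($t_{\mathrm{ind}}(\emptyset,\cdot)=1$, $0^0=1$). $\Gamma$ is transitive if $\Gamma=r\Gamma\oplus(1-r)\Gamma$ for all $r\in[0,1]$. $G(n,W)$ (resp. $G(\infty,W)$): draw $X_1,\dots,X_n$ (resp. $X_1,X_2,\dots$)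 i.i.d. from $\mu$ and independently for $i<j$ put edge $(i,j)$ with probability $W(X_i,X_j)$, else $(j,i)$. A countable tournament is transitive if $(i,j),(j,k)\in E$ imply $(i,k)\in E$. *)

(* Defs.v *)
From HB Require Import structures.
From mathcomp Require Import all_boot all_order all_algebra.
From mathcomp Require Import all_classical all_reals all_analysis.

Set Implicit Arguments.
Unset Strict Implicit.
Unset Printing Implicit Defensive.
Import Order.TTheory GRing.Theory Num.Theory.
Import numFieldNormedType.Exports.

Local Open Scope classical_set_scope.
Local Open Scope ring_scope.

(* The case [i = j] excludes loops; the case [i != j] says that exactly one of
   [(i, j)], [(j, i)] is an edge. *)
Definition tournament_rel (V : eqType) (e : rel V) : Prop :=
  forall i j, e i j = (i != j) && ~~ e j i.

(* Finite digraphs on ['I_n] are given by their edge sets. *)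
Definition is_tournament n (E : {set 'I_n * 'I_n}) : bool :=
  [forall i, forall j, ((i, j) \in E) == (i != j) && ((j, i) \notin E)].

Record tournament n := Tournament {
  edges :> {set 'I_n * 'I_n};
  edgesP : is_tournament edges }.

HB.instance Definition _ n := [isSub for @edges n].
HB.instance Definition _ n := [Finite of tournament n by <:].

Definition edge n (F : tournament n) : rel 'I_n :=
  fun i j => (i, j) \in edges F.

Lemma edgeE n (F : tournament n) : tournament_rel (edge F).
Proof. by move=> i j; apply/eqP; have /forallP/(_ i)/forallP/(_ j) := edgesP F. Qed.

Definition tournament_transitive n (F : tournament n) : bool :=
  [forall i, forall j, forall k, edge F i j ==> edge F j k ==> edge F i k].

Lemma tournament_transitiveP n (F : tournament n) :
  reflect (transitive (edge F)) (tournament_transitive F).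
Proof.
apply: (iffP idP) => [/forallP h j i k ij jk|h].
  by have /forallP/(_ j)/forallP/(_ k) := h i; rewrite ij jk.
apply/forallP => i; apply/forallP => j; apply/forallP => k.
by apply/implyP => ij; apply/implyP => jk; exact: h ij jk.
Qed.

Definition induced_edges n (F : tournament n) (A : {set 'I_n}) :
    {set 'I_#|A| * 'I_#|A|} :=
  [set p | edge F (enum_val p.1) (enum_val p.2)]%SET.

Lemma induced_subproof n (F : tournament n) (A : {set 'I_n}) :
  is_tournament (induced_edges F A).
Proof.
apply/forallP => i; apply/forallP => j; rewrite !inE/= edgeE.
by rewrite (inj_eq (@enum_val_inj _ _)).
Qed.

(* The subtournament of [F] induced by [A], with the vertices of [A] renamed
   increasingly to ['I_#|A|]. *)
Definition induced n (F : tournament n) (A : {set 'I_n}) : tournament #|A| :=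
  Tournament (induced_subproof F A).

Section densities.
Context {R : realType}.

Definition t_hom n m (F : {set 'I_n * 'I_n}) (G : tournament m) : R :=
  #|[set f : {ffun 'I_n -> 'I_m} |
      [forall i, forall j, ((i, j) \in F) ==> edge G (f i) (f j)]]%SET|%:R
  / (m ^ n)%:R.

Definition t_ind n m (F : tournament n) (G : tournament m) : R :=
  #|[set f : {ffun 'I_n -> 'I_m} | injectiveb f &&
      [forall i, forall j, edge G (f i) (f j) == edge F i j]]%SET|%:R
  / (m ^_ n)%:R.

Definition converges_to (m : nat -> nat) (G : forall k, tournament (m k))
    (t : forall n, tournament n -> R) : Prop :=
  [/\ m k @[k --> \oo] --> \oo,
      (forall n (F : {set 'I_n * 'I_n}), cvg (t_hom F (G k) @[k --> \oo])) &
      (forall n (F : tournament n), t_ind F (G k) @[k --> \oo] --> t n F)].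

End densities.

(* A tournament limit is determined by its induced densities, so it is
   represented by the family of these densities. *)
Record tournament_limit (R : realType) := TournamentLimit {
  lim_t_ind :> forall n, tournament n -> R;
  lim_t_indP : exists (m : nat -> nat) (G : forall k, tournament (m k)),
    converges_to G lim_t_ind }.

Arguments lim_t_ind {R} Gamma {n} F : rename.

(* Induced densities of [r Gamma1 (+) (1 - r) Gamma2]. The ordered partition
   of the vertices of [F] is [(A, ~: A)]; note that [0 ^+ 0 = 1]. *)
Definition oplus_t_ind (R : realType) (r : R) (Gamma1 Gamma2 : tournament_limit R)
    n (F : tournament n) : R :=
  \sum_(A : {set 'I_n} | [forall i in A, forall j in ~: A, edge F i j])
    r ^+ #|A| * (1 - r) ^+ #|~: A| *
    lim_t_ind Gamma1 (induced F A) * lim_t_ind Gamma2 (induced F (~: A)).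

Definition limit_transitive (R : realType) (Gamma : tournament_limit R) : Prop :=
  forall r : R, 0 <= r <= 1 -> forall n (F : tournament n),
    lim_t_ind Gamma F = oplus_t_ind r Gamma Gamma F.

Section power_probability.
Context d (S : measurableType d) (R : realType) (mu : probability S R).

Definition tuple_cons n (p : S * n.-tuple S) : n.+1.-tuple S :=
  [the n.+1.-tuple S of p.1 :: p.2].

Lemma measurable_tuple_cons n : measurable_fun [set: S * n.-tuple S] (@tuple_cons n).
Proof. exact: measurable_cons. Qed.

HB.instance Definition _ n :=
  @isMeasurableFun.Build _ _ _ _ (@tuple_cons n) (@measurable_tuple_cons n).

(* The product probability [mu^n] on [S^n]. *)
Fixpoint power_prob n : probability (n.-tuple S) R :=
  match n with
  | 0 => \d_([tuple] : 0.-tuple S)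
  | n'.+1 => distribution (mu \x power_prob n')%E (@tuple_cons n')
  end.

End power_probability.

Section kernels.
Context d (S : measurableType d) (R : realType) (mu : probability S R).
Variable W : S * S -> R.

Definition tournament_kernel : Prop :=
  [/\ measurable_fun [set: S * S] W,
      (forall p, 0 <= W p <= 1) &
      {ae (mu \x mu)%E, forall p, W (p.1, p.2) + W (p.2, p.1) = 1}].

Definition kernel_transitive : Prop :=
  {ae power_prob mu 3, forall t : 3.-tuple S,
    let x := tnth t (inord 0) in
    let y := tnth t (inord 1) in
    let z := tnth t (inord 2) in
    0 < W (x, y) -> 0 < W (y, z) -> W (x, z) = 1}.

Definition represents (Gamma : tournament_limit R) : Prop :=
  forall n (F : tournament n),
    (lim_t_ind Gamma F)%:E =
    (\int[power_prob mu n]_t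
       (\prod_(p in edges F) W (tnth t p.1, tnth t p.2))%:E)%E.

(* The conditional probability that the random tournament is [F], given that
   the vertex [i] is drawn at the point [tnth t i] for every [i]. *)
Definition edges_prob n (F : tournament n) (t : n.-tuple S) : R :=
  \prod_(i < n) \prod_(j < n | (i < j)%N)
    (if edge F i j then W (tnth t i, tnth t j) else 1 - W (tnth t i, tnth t j)).

(* The probability mass function of [G(n, W)]. *)
Definition Gn_prob n (F : tournament n) : \bar R :=
  (\int[power_prob mu n]_t (edges_prob F t)%:E)%E.

Definition Gn_as_transitive n : Prop :=
  (\sum_(F : tournament n | tournament_transitive F) Gn_prob F = 1)%E.

(* [E] is a version of the random tournament [G(oo, W)] on the probability
   space [(Om, P)]; vertices are numbered from 0. The last clause is the joint
   law of [X 0, ..., X n.-1] and of the edges among the vertices [0, ..., n.-1]: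
   the [X i] are i.i.d. with law [mu] and, given the [X i], the edges are
   independent and [(i, j)], for [i < j], is present with probability
   [W (X i, X j)]. *)
Definition Ginfty_version d' (Om : measurableType d') (P : probability Om R)
    (X : nat -> {RV P >-> S}) (E : Om -> rel nat) : Prop :=
  [/\ (forall w, tournament_rel (E w)),
      (forall i j, measurable [set w | E w i j]) &
      (forall n (F : tournament n) (A : set (n.-tuple S)), measurable A ->
        P [set w | A [tuple X i w | i < n] /\
                   forall i j : 'I_n, E w i j = edge F i j] =
        (\int[power_prob mu n]_(t in A) (edges_prob F t)%:E)%E)].

Definition Ginfty_as_transitive d' (Om : measurableType d')
    (P : probability Om R) (E : Om -> rel nat) : Prop :=
  {ae P, forall w, transitive (E w)}.

End kernels.

(* Main.v *)
Require Import Defs.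
From HB Require Import structures.
From mathcomp Require Import all_boot all_order all_algebra.
From mathcomp Require Import all_classical all_reals all_analysis.
From mathcomp Require Import measurable_realfun perm ring lra.

(** Everything is controlled by the density of the cyclic triangle [C3]. By the
symmetry of [W], that density vanishes iff [W x y * W y z * W z x = 0] almost
everywhere, iff [W] is transitive, and then every non-transitive tournament,
since it contains a cyclic triangle, has density [0] as well. The densities are
the point probabilities of [G(n, W)], and a tournament on [nat] is transitive iff
its finite restrictions are.

No cut with all edges in one direction splits [C3], so [r = 1/2] in the identity
[Gamma = r Gamma (+) (1 - r) Gamma] bounds its density by a quarter of itself.
Conversely, if only the transitive tournaments have positive density, each
of the [n!] labelled ones has density [1 / n!] by exchangeability; its cuts
are the [n + 1] initial segments, and the identity is the binomial theorem. *)

Set Implicit Arguments.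
Unset Strict Implicit.
Unset Printing Implicit Defensive.
Import Order.TTheory GRing.Theory Num.Theory.
Import numFieldNormedType.Exports.

Local Open Scope classical_set_scope.
Local Open Scope ring_scope.

(* [induced] also names a charge in [mathcomp.analysis.charge]. *)
Local Notation induced := Defs.induced.

(** * Finite tournaments and the cyclic triangle *)

Section finite_tournaments.
Context {R : realType}.

Lemma edge_irr n (F : tournament n) i : edge F i i = false.
Proof. by rewrite edgeE eqxx. Qed.

Lemma edge_asym n (F : tournament n) i j : edge F i j -> edge F j i = false.
Proof. by move=> ij; rewrite [LHS]edgeE ij andbF. Qed.

Lemma edge_total n (F : tournament n) i j : i != j -> ~~ edge F i j -> edge F j i.
Proof. by move=> ij nij; rewrite edgeE nij eq_sym ij. Qed.

Lemma tournament_inj n (F G : tournament n) : edge F =2 edge G -> F = G.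
Proof. by move=> FG; apply/val_inj/setP => -[i j]; exact: FG. Qed.

Lemma tournament_of_relP n (e : rel 'I_n) : tournament_rel e ->
  exists F : tournament n, edge F =2 e.
Proof.
move=> eP; have FP : is_tournament [set p | e p.1 p.2]%SET.
  by apply/forallP => i; apply/forallP => j; rewrite !inE/= -eP.
by exists (Tournament FP) => i j; rewrite /edge inE.
Qed.

(** If [i -> j -> k] without [i -> k], then [i] and [k] differ, since [j -> k] cannot reverse
    [i -> j]; so [k -> i] closes a triangle. *)
Lemma cyclic_triangleP n (F : tournament n) : ~~ tournament_transitive F ->
  exists i j k, [/\ edge F i j, edge F j k & edge F k i].
Proof.
move=> /forallPn[i /forallPn[j /forallPn[k]]].
rewrite !negb_imply => /and3P[ij jk nik]; exists i, j, k; split => //.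
apply: edge_total nik; apply/eqP => ik; move: jk.
by rewrite -ik (edge_asym ij).
Qed.

Lemma cyclic_triangle_not_transitive n (F : tournament n) i j k :
  edge F i j -> edge F j k -> edge F k i -> ~~ tournament_transitive F.
Proof.
move=> ij jk ki; apply/tournament_transitiveP => /(_ _ _ _ ij jk) ik.
by rewrite (edge_asym ik) in ki.
Qed.

Lemma C3_subproof :
  is_tournament [set p : 'I_3 * 'I_3 | p.2 == (p.1.+1 %% 3)%N :> nat]%SET.
Proof.
apply/forallP => -[[|[|[|//]]] ?]; apply/forallP => -[[|[|[|//]]] ?];
  by rewrite !inE.
Qed.

Definition C3 : tournament 3 := Tournament C3_subproof.

Lemma edge_C3 (i j : 'I_3) : edge C3 i j = (j == (i.+1 %% 3)%N :> nat).
Proof. by rewrite /edge inE. Qed.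

Lemma C3_not_transitive : ~~ tournament_transitive C3.
Proof.
by apply: (@cyclic_triangle_not_transitive _ _ (inord 0) (inord 1) (inord 2));
  rewrite edge_C3 !inordK.
Qed.

(** * Total mass of the induced densities *)

(** Double counting: each injective map pulls [G] back to exactly one tournament on [n] vertices.
    The bound [n <= m] makes the number of injections nonzero. *)
Lemma sum_t_ind n m (G : tournament m) : (n <= m)%N ->
  \sum_(F : tournament n) t_ind F G = 1 :> R.
Proof.
move=> nm.
pose Inj := [set f : {ffun 'I_n -> 'I_m} | injectiveb f]%SET.
pose pulled (f : {ffun 'I_n -> 'I_m}) (F : tournament n) :=
  [forall i, forall j, edge G (f i) (f j) == edge F i j].
have one f : f \in Inj -> (\sum_(F | pulled f F) 1 = 1)%N.
  rewrite inE => /injectiveP fI.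
  have [F FE] : exists F : tournament n,
      edge F =2 (fun i j => edge G (f i) (f j)).
    by apply: tournament_of_relP => i j; rewrite edgeE (inj_eq fI).
  rewrite (big_pred1 F)// => F'; apply/idP/eqP => [/forallP h|->].
    apply: tournament_inj => i j; have /forallP/(_ j)/eqP := h i.
    by rewrite FE => ->.
  by apply/forallP => i; apply/forallP => j; rewrite FE.
rewrite /t_ind -mulr_suml -natr_sum.
under eq_bigr do rewrite -sum1_card big_mkcond.
rewrite exchange_big/=.
have -> : (\sum_(f : {ffun 'I_n -> 'I_m}) \sum_(F : tournament n)
    (if f \in [set f : {ffun 'I_n -> 'I_m} | injectiveb f &&
      [forall i, forall j, edge G (f i) (f j) == edge F i j]]%SET then 1 else 0)
    = \sum_(f in Inj) 1)%N.
  rewrite [RHS]big_mkcond; apply: eq_bigr => f _.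
  rewrite -big_mkcond/=; case: ifPn => fI.
    rewrite -[RHS](one _ fI); apply: eq_bigl => F; rewrite inE.
    by move: fI; rewrite inE => ->.
  rewrite big_pred0// => F; apply/negbTE; apply: contra fI.
  by rewrite !inE => /andP[].
rewrite sum1_card (_ : #|Inj| = m ^_ n)%N; last first.
  by rewrite /Inj card_inj_ffuns !card_ord.
by rewrite divff// pnatr_eq0 -lt0n ffact_gt0.
Qed.

(** The sum is finite, so it passes to the limit; along the sequence it is eventually constant
    because the orders [m k] tend to infinity. *)
Lemma limit_sum (Gamma : tournament_limit R) n :
  \sum_(F : tournament n) lim_t_ind Gamma F = 1.
Proof.
have [m [G [mG _ cG]]] := lim_t_indP Gamma.
have c1 : (\sum_(F : tournament n) t_ind F (G k) : R) @[k --> \oo] -->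
    \sum_(F : tournament n) lim_t_ind Gamma F.
  by apply: cvg_big => [|F _]; [exact: add_continuous|exact: cG].
apply/esym; apply: (cvg_unique _ _ c1) => //.
apply: cvg_near_cst.
by move/cvgnyPge: mG => /(_ n); apply: filterS => k; exact: sum_t_ind.
Qed.

(** * Transitive tournaments as permutations *)

(** Here [s i] is the rank of the vertex [i] in a linear order, and edges go from lower to higher
    rank. *)
Definition perm_tournament_edges n (s : 'S_n) : {set 'I_n * 'I_n} :=
  [set p | (s p.1 < s p.2)%N]%SET.

Lemma perm_tournament_subproof n (s : 'S_n) :
  is_tournament (perm_tournament_edges s).
Proof.
apply/forallP => i; apply/forallP => j; rewrite !inE/= -leqNgt.
by rewrite ltn_neqAle -(inj_eq (@perm_inj _ s)).
Qed.

Definition perm_tournament n (s : 'S_n) : tournament n :=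
  Tournament (perm_tournament_subproof s).

Lemma edge_perm_tournament n (s : 'S_n) i j :
  edge (perm_tournament s) i j = (s i < s j)%N.
Proof. by rewrite /edge inE. Qed.

Lemma perm_tournament_transitive n (s : 'S_n) :
  tournament_transitive (perm_tournament s).
Proof.
apply/tournament_transitiveP => j i k; rewrite !edge_perm_tournament.
exact: ltn_trans.
Qed.

Lemma card_ltn_ord n k : (k <= n)%N -> #|[set i : 'I_n | (i < k)%N]%SET| = k.
Proof.
move=> kn; rewrite -sum1dep_card -(big_ord_widen _ (fun=> 1%N))//.
by rewrite sum1_card card_ord.
Qed.

Lemma card_perm_initial n (s : 'S_n) k : (k <= n)%N ->
  #|[set i : 'I_n | (s i < k)%N]%SET| = k.
Proof.
move=> kn; rewrite -[RHS](card_ltn_ord kn) -[RHS](card_preimset _ (@perm_inj _ s)).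
by apply: eq_card => i; rewrite !inE.
Qed.

(** The rank [s i] is recovered from the tournament as the in-degree of [i]. *)
Lemma perm_tournament_inj n : injective (@perm_tournament n).
Proof.
move=> s u su; apply/permP => i; apply/val_inj => /=.
rewrite -(@card_perm_initial _ s (s i)) ?(ltnW (ltn_ord _))//.
rewrite -(@card_perm_initial _ u (u i)) ?(ltnW (ltn_ord _))//.
by apply: eq_card => j; rewrite !inE -!edge_perm_tournament su.
Qed.

(** The in-degree serves as the rank. By transitivity an edge [i -> j] makes the in-neighbourhood of
    [i] a proper subset of that of [j], so in-degrees are distinct and increase along edges. *)
Lemma transitive_perm_tournament n (F : tournament n) :
  tournament_transitive F -> exists s, F = perm_tournament s.
Proof.
move=> /tournament_transitiveP Ftr.
pose D i := [set j | edge F j i]%SET.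
have Dlt i : (#|D i| < n)%N.
  rewrite -[ltnRHS]card_ord -cardsT; apply: proper_card.
  apply/properP; split; first by apply/fintype.subsetP => j; rewrite inE.
  by exists i; rewrite inE ?edge_irr.
have DE i j : edge F i j -> (#|D i| < #|D j|)%N.
  move=> ij; apply: proper_card; apply/properP; split.
    by apply/fintype.subsetP => k; rewrite !inE => ki; exact: Ftr ki ij.
  by exists i; rewrite !inE ?edge_irr.
pose r i := Ordinal (Dlt i).
have rI : injective r.
  move=> i j /(congr1 val)/= rij; apply/eqP; apply/negPn/negP => ij.
  case: (boolP (edge F i j)) => [/DE|/(edge_total ij)/DE]; by rewrite rij ltnn.
exists (perm rI); apply: tournament_inj => i j.
rewrite edge_perm_tournament !permE/=; apply/idP/idP => [/DE//|].
apply: contraLR => nij; rewrite -leqNgt.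
have [->//|ij] := eqVneq i j; exact/ltnW/DE/edge_total.
Qed.

(** * Induced subtournaments and directed cuts *)

Lemma induced_transitive n (F : tournament n) (A : {set 'I_n}) :
  tournament_transitive F -> tournament_transitive (induced F A).
Proof.
move=> /tournament_transitiveP Ftr; apply/tournament_transitiveP => j i k.
by rewrite /edge !inE; exact: Ftr.
Qed.

Lemma edge_induced n (F : tournament n) (A : {set 'I_n}) i j :
  edge (induced F A) i j = edge F (enum_val i) (enum_val j).
Proof. by rewrite /edge inE. Qed.

Lemma induced_triangle n (F : tournament n) (A : {set 'I_n}) i j k :
  i \in A -> j \in A -> k \in A ->
  edge F i j -> edge F j k -> edge F k i -> ~~ tournament_transitive (induced F A).
Proof.
move=> iA jA kA ij jk ki.
apply: (@cyclic_triangle_not_transitive _ _ (enum_rank_in iA i)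
  (enum_rank_in iA j) (enum_rank_in iA k));
  by rewrite edge_induced !enum_rankK_in.
Qed.

(** The first side of a directed cut is closed under in-neighbours; all later facts on cuts use this
    form. *)
Lemma cut_closed n (F : tournament n) (A : {set 'I_n}) x y :
  [forall i in A, forall j in ~: A, edge F i j] ->
  edge F y x -> x \in A -> y \in A.
Proof.
move=> /forall_inP cut yx xA; apply/negPn/negP => yA.
have /forall_inP/(_ y) := cut x xA; rewrite inE => /(_ yA).
by rewrite (edge_asym yx).
Qed.

(* A cyclic triangle cannot be split by a cut with all edges directed across it. *)
Lemma cut_not_transitive n (F : tournament n) (A : {set 'I_n}) :
  [forall i in A, forall j in ~: A, edge F i j] ->
  ~~ tournament_transitive F ->
  ~~ tournament_transitive (induced F A) ||
  ~~ tournament_transitive (induced F (~: A)).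
Proof.
move=> cut /cyclic_triangleP[i [j [k [ij jk ki]]]].
have cutP x y := @cut_closed _ F A x y cut.
have [iA|iA] := boolP (i \in A).
  have kA := cutP _ _ ki iA; have jA := cutP _ _ jk kA.
  by rewrite (@induced_triangle _ _ _ i j k).
have jA : j \notin A by apply: contra iA; exact: cutP.
have kA : k \notin A by apply: contra jA; exact: cutP.
by apply/orP; right; apply: (@induced_triangle _ _ _ i j k); rewrite ?inE.
Qed.

Lemma C3_cut (A : {set 'I_3}) :
  [forall i in A, forall j in ~: A, edge C3 i j] ->
  (A == finset.set0) || (A == [set: 'I_3]%SET).
Proof.
move=> cut; have cutP x y := @cut_closed _ C3 A x y cut.
have [->|/set0Pn[i iA]] := eqVneq A finset.set0; first by [].
apply/eqP/setP => x; rewrite inE.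
have [->//|xi] := eqVneq x i.
have [/cutP|/(edge_total xi) ix] := boolP (edge C3 x i); first exact.
(* In the remaining case [i -> x], and the third vertex [x + 1] modulo 3 closes the triangle. It
   precedes [i], hence lies in [A], and [x] precedes it. *)
have zlt : (x.+1 %% 3 < 3)%N by rewrite ltn_mod.
apply: (cutP (Ordinal zlt)); first by rewrite edge_C3.
apply: (cutP i) => //; move: ix; rewrite !edge_C3/= => /eqP ->.
by case: i {iA xi} => -[|[|[|//]]].
Qed.

(** The directed cuts of a linear order are its initial segments, exactly one of each size from [0]
    to [n]. *)
Lemma sum_perm_cuts n (s : 'S_n) (V : zmodType) (g : nat -> V) :
  \sum_(A : {set 'I_n} |
     [forall i in A, forall j in ~: A, edge (perm_tournament s) i j]) g #|A| =
  \sum_(k < n.+1) g k.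
Proof.
pose h (k : 'I_n.+1) : {set 'I_n} := [set i | (s i < k)%N]%SET.
have hcard k : #|h k| = k by rewrite card_perm_initial// -ltnS.
(* The inverse of [h] sends a cut to its size. A cut containing [i] contains all [s i + 1] vertices
   of rank at most [s i], so [s i < #|A|]; this gives [A] inside [h #|A|], and the sizes agree. *)
rewrite (reindex_onto h (fun A => inord #|A|))/=; last first.
  move=> A /forall_inP cut; apply/esym/eqP; rewrite eqEcard hcard.
  have An : (#|A| < n.+1)%N by rewrite ltnS -[leqRHS]card_ord max_card.
  rewrite inordK// leqnn andbT; apply/fintype.subsetP => i iA; rewrite inE inordK//.
  rewrite -(@card_perm_initial _ s (s i).+1)//; apply: subset_leq_card.
  apply/fintype.subsetP => j; rewrite inE ltnS => ji; apply/negPn/negP => jA.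
  have /forall_inP/(_ j) := cut i iA; rewrite inE => /(_ jA).
  by rewrite edge_perm_tournament ltnNge ji.
apply: eq_big => [k|k _]; last by rewrite hcard.
rewrite hcard inord_val eqxx andbT; apply/forall_inP => i; rewrite inE => ik.
apply/forall_inP => j; rewrite !inE edge_perm_tournament -leqNgt.
exact: leq_trans.
Qed.

Lemma oplus_transitive (Gamma : tournament_limit R) (r : R) :
  (forall n (F : tournament n), tournament_transitive F ->
     lim_t_ind Gamma F = n`!%:R^-1) ->
  forall n (F : tournament n), tournament_transitive F ->
     oplus_t_ind r Gamma Gamma F = n`!%:R^-1.
Proof.
move=> Gtr n F Ftr; have [s Fs] := transitive_perm_tournament Ftr.
pose g k := r ^+ k * (1 - r) ^+ (n - k) * k`!%:R^-1 * (n - k)`!%:R^-1 : R.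
transitivity (\sum_(k < n.+1) g k).
  rewrite -(sum_perm_cuts s) /oplus_t_ind Fs; apply: eq_bigr => A _.
  rewrite !Gtr; try by apply: induced_transitive; rewrite -Fs.
  suff -> : #|~: A| = (n - #|A|)%N by [].
  by have /(congr1 (subn^~ #|A|)) := cardsC A; rewrite addKn card_ord.
have nz k : k`!%:R != 0 :> R by rewrite pnatr_eq0 -lt0n fact_gt0.
(* After multiplication by [n!], the term [g k] becomes the [k]-th term in the binomial expansion of
   [(1 - r + r) ^ n = 1]. *)
apply: (mulfI (nz n)); rewrite divff// mulr_sumr.
rewrite -[RHS](expr1n _ n) -[X in _ = X ^+ _](subrK r 1) exprDn.
apply: eq_bigr => k _; rewrite -[RHS]mulr_natr.
have -> : n`!%:R = 'C(n, k)%:R * (k`!%:R * (n - k)`!%:R) :> R.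
  by rewrite -!natrM bin_fact// -ltnS.
rewrite /g.
have regroup (a b c b' c' x y : R) :
  a * (b * c) * (x * y * b' * c') = y * x * a * (b * b') * (c * c') by ring.
by rewrite regroup !divff// !mulr1.
Qed.

(** Every cut leaves a cyclic triangle whole on one side, so each summand has a vanishing factor. *)
Lemma oplus_not_transitive (Gamma : tournament_limit R) (r : R) :
  (forall n (F : tournament n), ~~ tournament_transitive F ->
     lim_t_ind Gamma F = 0) ->
  forall n (F : tournament n), ~~ tournament_transitive F ->
     oplus_t_ind r Gamma Gamma F = 0.
Proof.
move=> G0 n F Ftr; apply: big1 => A /cut_not_transitive/(_ Ftr)/orP[] /G0 ->.
  by rewrite mulr0 mul0r.
by rewrite mulr0.
Qed.

End finite_tournaments.

(** * Product measures on tuples *)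

Section power_probability_theory.
Context d (S : measurableType d) (R : realType) (mu : probability S R).

Definition box n (A : 'I_n -> set S) : set (n.-tuple S) :=
  [set t | forall i, A i (tnth t i)].

Lemma measurable_box n (A : 'I_n -> set S) :
  (forall i, measurable (A i)) -> measurable (box A).
Proof.
move=> mA.
have -> : box A = \bigcap_(i in [set: 'I_n]) ((@tnth n S)^~ i @^-1` A i).
  by apply/seteqP; split => t /= h i; [move=> _; exact: h|exact: (h i I)].
apply: fin_bigcap_measurable; first exact: finite_finset.
by move=> i _; rewrite -[X in measurable X]setTI; exact: measurable_tnth.
Qed.

Lemma power_prob_box n (A : 'I_n -> set S) : (forall i, measurable (A i)) ->
  power_prob mu n (box A) = (\prod_(i < n) mu (A i))%E.
Proof.
elim: n A => [|n IH] A mA.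
  by rewrite big_ord0 /= diracE mem_set// => -[].
rewrite big_ord_recl -IH; last by move=> i; exact: mA.
rewrite -product_measure1E//; last by apply: measurable_box => i; exact: mA.
rewrite /= /distribution /pushforward; congr (product_measure1 _ _ _).
apply/seteqP; split => -[x t] /=.
  move=> h; split => /=; first by have := h ord0; rewrite tnth0.
  by move=> i; have := h (lift ord0 i); rewrite tnthS.
move=> [/= h0 h] i; case: (unliftP ord0 i) => [j ->|->].
  by rewrite tnthS; exact: h.
by rewrite tnth0.
Qed.

(** Boxes form an intersection-stable generator, as uniqueness of measures requires. A cylinder over
    one coordinate is a box with all other sides [setT]. *)
Lemma measurable_tuple_box n :
  @measurable _ (n.-tuple S) =
  <<s [set box A | A in [set A : 'I_n -> set S | forall i, measurable (A i)]] >>.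
Proof.
apply/seteqP; split; last first.
  apply: smallest_sub; first exact: sigma_algebra_measurable.
  by move=> _ [A mA <-]; exact: measurable_box.
apply: smallest_sub; first exact: smallest_sigma_algebra.
rewrite -bigcup_seq; apply: bigcup_sub => i _ B [C mC <-].
apply: sub_sigma_algebra; exists (fun j => if j == i then C else setT).
  by move=> j; case: ifP.
apply/seteqP; split => t /= h.
  by have := h i; rewrite eqxx.
by case: h => _ h j; case: eqP => // ->.
Qed.

Definition restrict_tuple k n (f : 'I_k -> 'I_n) (t : n.-tuple S) : k.-tuple S :=
  [tuple tnth t (f i) | i < k].

Lemma measurable_restrict_tuple k n (f : 'I_k -> 'I_n) :
  measurable_fun setT (restrict_tuple f).
Proof.
apply/measurable_fun_tnthP => i.
rewrite (_ : _ \o _ = (@tnth n S)^~ (f i)); first exact: measurable_tnth.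
by apply/funext => t; rewrite /= tnth_mktuple.
Qed.

HB.instance Definition _ k n (f : 'I_k -> 'I_n) :=
  isMeasurableFun.Build _ _ _ _ (restrict_tuple f) (measurable_restrict_tuple f).

(** Both sides are measures in [A], so it suffices to compare them on boxes. The preimage of a box
    is a box, and the coordinates outside the image of [f] contribute factors [1]. *)
Lemma power_prob_marginal k n (f : 'I_k -> 'I_n) (A : set (k.-tuple S)) :
  injective f -> measurable A ->
  power_prob mu n (restrict_tuple f @^-1` A) = power_prob mu k A.
Proof.
move=> fI mA.
transitivity (distribution (power_prob mu n) (restrict_tuple f) A); first by [].
apply: (measure_unique _ (fun=> setT) (@measurable_tuple_box k)) => //.
- move=> _ _ [A1 mA1 <-] [A2 mA2 <-].
  exists (fun i => A1 i `&` A2 i); first by move=> i; exact: measurableI.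
  apply/seteqP; split => t /=; first by move=> h; split=> i; have [] := h i.
  by move=> [h1 h2] i; split.
- by move=> _; exists (fun=> setT) => //; apply/seteqP; split.
- by apply/seteqP; split => // t _; exists 0%N.
- move=> _ [B mB <-].
  transitivity (\prod_(i < k) mu (B i))%E; last exact/esym/power_prob_box.
  change (power_prob mu n (restrict_tuple f @^-1` box B) =
    \prod_(i < k) mu (B i))%E.
  (* The side at coordinate [f i] is [B i], unambiguously since [f] is injective; coordinates that
     [f] misses are unconstrained. *)
  pose C j := if [pick i | f i == j] is Some i then B i else setT.
  have CE i : C (f i) = B i.
    rewrite /C; case: pickP => [j /eqP/fI ->//|/(_ i)]; by rewrite eqxx.
  have -> : restrict_tuple f @^-1` box B = box C.
    apply/seteqP; split => t /= h j.
      rewrite /C; case: pickP => // i /eqP <-.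
      by have := h i; rewrite tnth_mktuple.
    by rewrite tnth_mktuple -CE; exact: h.
  rewrite power_prob_box; last by move=> j; rewrite /C; case: pickP.
  rewrite (bigID [in codom f])/= [X in (_ * X)%E]big1 ?mule1; last first.
    move=> j jf; rewrite /C; case: pickP => [i /eqP ij|_].
      by rewrite -ij codom_f in jf.
    exact: probability_setT.
  rewrite -big_uniq; last by rewrite map_inj_uniq ?enum_uniq.
  by rewrite big_image; apply: eq_bigr => i _; rewrite CE.
- by move=> _; rewrite (le_lt_trans (probability_le1 _ _)) ?ltry.
Qed.

(** The kernel identity holds almost everywhere on [S * S], whereas densities integrate over tuples;
    this passes from one to the other. Rectangles determine the product measure. *)
Lemma power_prob_marginal2 n (i j : 'I_n) (A : set (S * S)) :
  i != j -> measurable A ->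
  power_prob mu n [set t | A (tnth t i, tnth t j)] = (mu \x mu)%E A.
Proof.
move=> ij mA.
have mpair : measurable_fun setT (fun t : n.-tuple S => (tnth t i, tnth t j)).
  by apply/measurable_fun_pair; exact: measurable_tnth.
pose h := [the {mfun _ >-> _} of mfun_Sub (mem_set mpair)].
transitivity (distribution (power_prob mu n) h A); first by [].
apply/esym; apply: product_measure_unique => // A1 A2 mA1 mA2.
change (power_prob mu n (h @^-1` (A1 `*` A2)) = (mu A1 * mu A2)%E).
pose B l := if l == i then A1 else if l == j then A2 else setT.
have -> : h @^-1` (A1 `*` A2) = box B.
  apply/seteqP; split => t /=.
    move=> [/= ti tj] l; rewrite /B; case: eqP => [->//|_].
    by case: eqP => [->|].
  move=> h'; split => /=; first by have := h' i; rewrite /B eqxx.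
  by have := h' j; rewrite /B eqxx [j == i]eq_sym (negbTE ij).
rewrite power_prob_box; last by move=> l; rewrite /B; do 2 case: ifP => //.
rewrite (bigD1 i)//= (bigD1 j)/=; last by rewrite eq_sym.
rewrite /B eqxx [j == i]eq_sym (negbTE ij) eqxx big1 ?mule1//.
move=> l /andP[/negbTE -> /negbTE ->].
exact: probability_setT.
Qed.

Lemma ae_restrict_tuple k n (f : 'I_k -> 'I_n) (Q : k.-tuple S -> Prop) :
  injective f -> {ae power_prob mu k, forall t, Q t} ->
  {ae power_prob mu n, forall t, Q (restrict_tuple f t)}.
Proof.
move=> fI [N [mN N0 QN]]; exists (restrict_tuple f @^-1` N); split.
- by rewrite -[X in measurable X]setTI; exact: measurable_restrict_tuple.
- by rewrite power_prob_marginal.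
- by move=> t /= nQ; exact: QN.
Qed.

Lemma ae_tnth2 n (i j : 'I_n) (Q : S * S -> Prop) : i != j ->
  {ae (mu \x mu)%E, forall p, Q p} ->
  {ae power_prob mu n, forall t, Q (tnth t i, tnth t j)}.
Proof.
move=> ij [N [mN N0 QN]]; exists [set t | N (tnth t i, tnth t j)]; split.
- have /(_ measurableT N mN) := @measurable_fun_pair _ _ _ _ _ _ _ _
    (@measurable_tnth _ S n i) (@measurable_tnth _ S n j).
  by rewrite setTI.
- by rewrite power_prob_marginal2.
- by move=> t /= nQ; exact: QN.
Qed.

End power_probability_theory.

(** * Densities as integrals of the kernel *)

Section represented_limit.
Context (R : realType) d (S : measurableType d) (mu : probability S R).
Context (W : S * S -> R) (Gamma : tournament_limit R).
Hypotheses (hW : tournament_kernel mu W) (hGamma : represents mu W Gamma).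

Let Wprod n (F : tournament n) (t : n.-tuple S) : R :=
  \prod_(p in edges F) W (tnth t p.1, tnth t p.2).

Let W_ge0 p : 0 <= W p.
Proof. by have [_ /(_ p)/andP[]] := hW. Qed.

Let W_le1 p : W p <= 1.
Proof. by have [_ /(_ p)/andP[]] := hW. Qed.

Let measurable_W_tnth n (i j : 'I_n) :
  measurable_fun setT (fun t : n.-tuple S => W (tnth t i, tnth t j)).
Proof.
have [mW _ _] := hW; apply: (measurableT_comp mW).
by apply/measurable_fun_pair; exact: measurable_tnth.
Qed.

Let Wprod_ge0 n (F : tournament n) t : 0 <= Wprod F t.
Proof. exact: prodr_ge0. Qed.

Let measurable_Wprod n (F : tournament n) : measurable_fun setT (Wprod F).
Proof.
rewrite (_ : Wprod F = fun t =>
    \prod_(p <- enum (edges F)) W (tnth t p.1, tnth t p.2)).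
  by apply: measurable_prod => p _; exact: measurable_W_tnth.
by apply/funext => t; rewrite big_enum.
Qed.

Let edges_prob_ge0 n (F : tournament n) t : 0 <= edges_prob W F t.
Proof.
apply: prodr_ge0 => i _; apply: prodr_ge0 => j _.
by case: ifP => _ //; rewrite subr_ge0.
Qed.

Let measurable_edges_prob n (F : tournament n) :
  measurable_fun setT (edges_prob W F).
Proof.
apply: measurable_prod => i _.
rewrite [X in measurable_fun _ X](_ : _ = fun t => \prod_(j < n)
    if (i < j)%N then if edge F i j then W (tnth t i, tnth t j)
                      else 1 - W (tnth t i, tnth t j) else 1); last first.
  by apply/funext => t; rewrite big_mkcond.
apply: measurable_prod => j _; case: (i < j)%N => //; case: (edge F i j).
  exact: measurable_W_tnth.
by apply: measurable_funB => //; exact: measurable_W_tnth.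
Qed.

(** The almost sure event on which the pointwise computations take place. Equal indices are excluded
    because the diagonal may be a null set, where the kernel identity says nothing. *)
Let Wsym n (t : n.-tuple S) := forall i j : 'I_n, i != j ->
  W (tnth t i, tnth t j) + W (tnth t j, tnth t i) = 1.

Let ae_Wsym n : {ae power_prob mu n, forall t, Wsym t}.
Proof.
have [_ _ hsym] := hW.
apply: filter_forall => i; apply: filter_forall => j.
have [->|ij] := eqVneq i j; first exact: nearW.
by apply: filterS (ae_tnth2 ij hsym) => t.
Qed.

(** For [i < j] with [j -> i], the factor [1 - W(x_i, x_j)] equals [W(x_j, x_i)] by symmetry. *)
Let edges_probE n (F : tournament n) t : Wsym t -> edges_prob W F t = Wprod F t.
Proof.
move=> tsym; pose w i j := W (tnth t i, tnth t j).
pose g i j := if edge F i j then w i j else 1.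
have -> : Wprod F t = \prod_i \prod_j g i j.
  by rewrite /Wprod big_mkcond pair_bigA; apply: eq_bigr => -[].
have split i : \prod_j g i j =
    (\prod_(j < n | (i < j)%N) g i j) * \prod_(j < n | (j < i)%N) g i j.
  rewrite (bigID (fun j : 'I_n => (i < j)%N))/=; congr (_ * _).
  rewrite (bigID (fun j : 'I_n => (j < i)%N))/= [X in _ * X]big1 ?mulr1.
    by apply: eq_bigl => j; rewrite -leqNgt andb_idl// => /ltnW.
  move=> j; rewrite -!leqNgt -eqn_leq => /eqP/val_inj ->.
  by rewrite /g edge_irr.
under [RHS]eq_bigr do rewrite split.
(* Exchanging the indices in the second half groups [g i j] with [g j i] for each [i < j]; one of
   the two is always [1]. *)
rewrite big_split/= [X in _ * X](exchange_big_dep xpredT)//= -big_split/=.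
apply: eq_bigr => i _; rewrite -big_split/=; apply: eq_bigr => j ij.
have ij' : i != j by rewrite neq_ltn ij.
rewrite /g; case: ifPn => eij; first by rewrite (edge_asym eij) mulr1.
by rewrite edge_total// mul1r -(tsym _ _ ij') addrC addKr.
Qed.

Lemma limit_integral n (F : tournament n) :
  (lim_t_ind Gamma F)%:E = (\int[power_prob mu n]_t (Wprod F t)%:E)%E.
Proof. exact: hGamma. Qed.

Lemma limit_ge0 n (F : tournament n) : 0 <= lim_t_ind Gamma F.
Proof.
rewrite -lee_fin limit_integral; apply: integral_ge0 => t _.
by rewrite lee_fin.
Qed.

Lemma limit_le1 n (F : tournament n) : lim_t_ind Gamma F <= 1.
Proof.
rewrite -(limit_sum Gamma n) (bigD1 F)//= lerDl.
by apply: sumr_ge0 => F' _; exact: limit_ge0.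
Qed.

Lemma Gn_probE n (F : tournament n) : Gn_prob mu W F = (lim_t_ind Gamma F)%:E.
Proof.
rewrite limit_integral; apply: ge0_ae_eq_integral => //.
- apply/measurable_EFinP; exact: measurable_edges_prob.
- apply/measurable_EFinP; exact: measurable_Wprod.
- by move=> t _; rewrite lee_fin.
- by move=> t _; rewrite lee_fin.
- by apply: filterS (@ae_Wsym n) => t tsym _; rewrite edges_probE.
Qed.

Let limit_eq0 n (F : tournament n) :
  lim_t_ind Gamma F = 0 <-> {ae power_prob mu n, forall t, Wprod F t = 0}.
Proof.
have mWp : measurable_fun setT (EFin \o Wprod F).
  apply/measurable_EFinP; exact: measurable_Wprod.
have [h1 h2] := ae_eq_integral_abs (power_prob mu n) measurableT mWp.
have intE : (\int[power_prob mu n]_t `|(EFin \o Wprod F) t| =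
    (lim_t_ind Gamma F)%:E)%E.
  rewrite limit_integral; apply: eq_integral => t _ /=.
  by rewrite ger0_norm.
rewrite intE in h1 h2; split => [F0|F0].
  by have := h1; rewrite F0 => /(_ erefl); apply: filterS => t /= /(_ I) [].
by apply: (@EFin_inj R); apply: h2; apply: filterS F0 => t /= -> _.
Qed.

(** Relabelling preserves the law of i.i.d. points, so this is a change of variables along
    [restrict_tuple f]. The orders [k] and [n] are kept apart because [induced] lives on
    ['I_#|A|]. *)
Lemma limit_iso k n (F' : tournament k) (F : tournament n) (f : 'I_k -> 'I_n) :
  bijective f -> (forall i j, edge F' i j = edge F (f i) (f j)) ->
  lim_t_ind Gamma F' = lim_t_ind Gamma F.
Proof.
move=> fbij fE; apply: (@EFin_inj R); rewrite !limit_integral.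
have fI := bij_inj fbij.
transitivity (\int[distribution (power_prob mu n) (restrict_tuple f)]_t
    (Wprod F' t)%:E)%E.
  by apply: eq_measure_integral => A mA _; exact/esym/power_prob_marginal.
rewrite ge0_integral_distribution; last 2 first.
- apply/measurable_EFinP; exact: measurable_Wprod.
- by move=> t; rewrite lee_fin.
apply: eq_integral => t _ /=; congr EFin; rewrite /Wprod.
have [g fK gK] := fbij.
rewrite [RHS](reindex (fun p => (f p.1, f p.2)))/=; last first.
  by exists (fun p => (g p.1, g p.2)) => -[i j] _ /=; rewrite ?fK ?gK.
apply: eq_big => [[i j]|[i j] _]; first exact: fE.
by rewrite !tnth_mktuple.
Qed.

(** * Transitivity of the kernel and the cyclic triangle *)

(** On a cyclic triangle [i, j, k] of [F], if the factors of [i -> j] and [j -> k] are positive,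
    then [W(x_i, x_k) = 1], and symmetry makes the factor of [k -> i] zero. The product thus
    vanishes almost everywhere. *)
Lemma kernel_transitive_limit0 : kernel_transitive mu W ->
  forall n (F : tournament n), ~~ tournament_transitive F ->
  lim_t_ind Gamma F = 0.
Proof.
move=> Wtr n F /cyclic_triangleP[i [j [k [ij jk ki]]]]; apply/limit_eq0.
pose f := tnth [tuple i; j; k].
have nij : i != j by apply: contraTneq ij => ->; rewrite edge_irr.
have njk : j != k by apply: contraTneq jk => ->; rewrite edge_irr.
have nki : k != i by apply: contraTneq ki => ->; rewrite edge_irr.
have fI : injective f.
  by apply/tuple_uniqP; rewrite /= !inE negb_or nij njk eq_sym nki.
apply: filterS2 (ae_restrict_tuple fI Wtr) (@ae_Wsym n) => t /=.
rewrite !tnth_mktuple /f !(tnth_nth i) !inordK//= => ttr tsym.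
apply/eqP; rewrite prodf_seq_eq0; apply/hasP.
have [W0|W1] := eqVneq (W (tnth t i, tnth t j)) 0.
  by exists (i, j); rewrite ?mem_index_enum//= W0 eqxx andbT.
have [W0|W2] := eqVneq (W (tnth t j, tnth t k)) 0.
  by exists (j, k); rewrite ?mem_index_enum//= W0 eqxx andbT.
exists (k, i); rewrite ?mem_index_enum//=; apply/andP; split => //.
have ik1 : W (tnth t i, tnth t k) = 1 by apply: ttr; rewrite lt0r ?W1 ?W2 ?W_ge0.
have := tsym _ _ nki; rewrite ik1 => /eqP.
by rewrite -[X in _ == X]add0r (inj_eq (addIr _)).
Qed.

(** Almost everywhere one of the three factors is zero. When [W(x, y)] and [W(y, z)] are positive it
    must be [W(z, x)], whence [W(x, z) = 1] by symmetry. *)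
Lemma limit_C3_kernel_transitive :
  lim_t_ind Gamma C3 = 0 -> kernel_transitive mu W.
Proof.
move=> /limit_eq0 C30; apply: filterS2 C30 (@ae_Wsym 3) => t /eqP.
rewrite /Wprod prodf_seq_eq0 => /hasP[[i j] _ /= /andP[ij /eqP Wij]] tsym W1 W2.
have := edge_C3 i j; rewrite [LHS]ij => /esym/eqP jE.
case: i ij jE Wij => -[|[|[|//]]] im ij /= jE Wij.
- have i0 : Ordinal im = inord 0 by apply/val_inj; rewrite /= inordK.
  have j1 : j = inord 1 by apply/val_inj; rewrite /= inordK.
  by move: W1; rewrite -i0 -j1 Wij ltxx.
- have i1 : Ordinal im = inord 1 by apply/val_inj; rewrite /= inordK.
  have j2 : j = inord 2 by apply/val_inj; rewrite /= inordK.
  by move: W2; rewrite -i1 -j2 Wij ltxx.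
- have i2 : Ordinal im = inord 2 by apply/val_inj; rewrite /= inordK.
  have j0 : j = inord 0 by apply/val_inj; rewrite /= inordK.
  have n02 : inord 0 != inord 2 :> 'I_3 by rewrite -val_eqE /= !inordK.
  by rewrite -(tsym _ _ n02) -i2 -j0 Wij addr0.
Qed.

Lemma kernel_transitiveP : kernel_transitive mu W <->
  forall n (F : tournament n), ~~ tournament_transitive F ->
    lim_t_ind Gamma F = 0.
Proof.
split; first exact: kernel_transitive_limit0.
by move=> h; apply/limit_C3_kernel_transitive/h/C3_not_transitive.
Qed.

(** * Transitivity of the limit *)

Lemma limit_perm_tournament n (s : 'S_n) :
  lim_t_ind Gamma (perm_tournament s) =
  lim_t_ind Gamma (perm_tournament (perm_one 'I_n)).
Proof.
apply: (@limit_iso _ _ _ _ s); first exact/injF_bij/perm_inj.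
by move=> i j; rewrite !edge_perm_tournament !permE.
Qed.

(** The densities sum to [1] and are carried by the [n!] tournaments [perm_tournament s], which are
    isomorphic and so have equal densities. *)
Lemma limit_of_transitive :
  (forall n (F : tournament n), ~~ tournament_transitive F ->
     lim_t_ind Gamma F = 0) ->
  forall n (F : tournament n), tournament_transitive F ->
    lim_t_ind Gamma F = n`!%:R^-1.
Proof.
move=> G0 n F /transitive_perm_tournament[s ->].
have := limit_sum Gamma n.
rewrite (bigID (@tournament_transitive n))/= [X in _ + X]big1 ?addr0; last first.
  by move=> F'; exact: G0.
rewrite (eq_bigl [in [set perm_tournament s | s : 'S_n]%SET]); last first.
  move=> F'; apply/idP/imsetP => [/transitive_perm_tournament[u ->]|[u _ ->]].
    by exists u.
  exact: perm_tournament_transitive.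
rewrite big_imset/=; last by move=> u v _ _; exact: perm_tournament_inj.
under eq_bigr do rewrite limit_perm_tournament.
rewrite sumr_const card_Sn => n1; rewrite limit_perm_tournament.
have nz : n`!%:R != 0 :> R by rewrite pnatr_eq0 -lt0n fact_gt0.
by apply: (mulIf nz); rewrite mulVf// mulr_natr.
Qed.

Lemma limit_transitive_C3 : limit_transitive Gamma -> lim_t_ind Gamma C3 = 0.
Proof.
move=> Gtr.
have half : 0 <= (2^-1 : R) <= 1 by lra.
pose g (A : {set 'I_3}) : R := 2^-1 ^+ #|A| * (1 - 2^-1) ^+ #|~: A| *
    lim_t_ind Gamma (induced C3 A) * lim_t_ind Gamma (induced C3 (~: A)).
have g_ge0 A : 0 <= g A.
  by rewrite /g !mulr_ge0 ?limit_ge0// exprn_ge0//; lra.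
have GT : lim_t_ind Gamma (induced C3 [set: 'I_3]%SET) = lim_t_ind Gamma C3.
  apply: (@limit_iso _ _ _ _ (fun i => enum_val i)).
    apply: inj_card_bij; first exact: enum_val_inj.
    by rewrite !card_ord cardsT card_ord.
  by move=> i j; rewrite edge_induced.
have le : lim_t_ind Gamma C3 <= g finset.set0 + g [set: 'I_3]%SET.
  rewrite (Gtr _ half) /oplus_t_ind.
  have -> : g finset.set0 + g [set: 'I_3]%SET =
      \sum_(A in [set finset.set0; [set: 'I_3]]%SET) g A.
    rewrite big_setU1/= ?big_set1// inE.
    by apply/eqP => /setP/(_ ord0); rewrite !inE.
  rewrite big_mkcond [leRHS]big_mkcond; apply: ler_sum => A _.
  case: ifP => [/C3_cut cA|_]; first by rewrite !inE cA.
  by case: ifP.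
apply/eqP; rewrite eq_le limit_ge0 andbT.
(* With [x] the density of [C3] and [y <= 1] that of the empty tournament, the two trivial cuts give
   [x <= x y / 8 + x y / 8], hence [x <= x / 4]. *)
move: le; rewrite /g finset.setC0 finset.setCT GT.
move: (limit_ge0 C3) (limit_ge0 (induced C3 finset.set0)).
move: (limit_le1 (induced C3 finset.set0)).
move: (lim_t_ind Gamma (induced _ _)) (lim_t_ind Gamma C3) => y x.
rewrite cards0 cardsT card_ord => y1 x0 y0; nra.
Qed.

Lemma limit_transitiveP : limit_transitive Gamma <-> kernel_transitive mu W.
Proof.
split=> [/limit_transitive_C3/limit_C3_kernel_transitive//|].
move=> /kernel_transitiveP G0 r _ n F.
have [Ftr|Ftr] := boolP (tournament_transitive F).
  rewrite oplus_transitive//; first exact: limit_of_transitive.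
  exact: limit_of_transitive.
by rewrite oplus_not_transitive// G0.
Qed.

(** * The random tournaments *)

(** All probabilities sum to [1], so the transitive ones do iff the nonnegative remaining terms
    vanish one by one. *)
Lemma Gn_as_transitiveP n : Gn_as_transitive mu W n <->
  forall F : tournament n, ~~ tournament_transitive F -> lim_t_ind Gamma F = 0.
Proof.
rewrite /Gn_as_transitive; under eq_bigr do rewrite Gn_probE.
rewrite sumEFin.
have := limit_sum Gamma n; rewrite (bigID (@tournament_transitive n))/= => h.
split=> [[tr1] F Ftr|h0]; last first.
  by rewrite -h [X in _ + X]big1 ?addr0.
have /eqP : \sum_(F : tournament n | ~~ tournament_transitive F) lim_t_ind Gamma F = 0.
  by apply: (addrI 1); rewrite addr0 -{1}tr1.
rewrite psumr_eq0 => [/allP/(_ F)|F' _]; last exact: limit_ge0.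
by rewrite mem_index_enum Ftr => /(_ isT)/eqP.
Qed.

Lemma Ginfty_as_transitiveP d' (Om : measurableType d') (P : probability Om R)
    (X : nat -> {RV P >-> S}) (E : Om -> rel nat) : Ginfty_version mu W X E ->
  kernel_transitive mu W <-> Ginfty_as_transitive P E.
Proof.
move=> [Etour mE EP].
pose ev n (F : tournament n) := [set w | forall i j : 'I_n, E w i j = edge F i j].
have Pev n (F : tournament n) : P (ev n F) = (lim_t_ind Gamma F)%:E.
  rewrite -Gn_probE /Gn_prob -(EP n F setT measurableT); congr (P _).
  by apply/seteqP; split => w /= => [h|[]].
have mev n (F : tournament n) : measurable (ev n F).
  have -> : ev n F = \bigcap_(p in [set: 'I_n * 'I_n])
      [set w | E w p.1 p.2 = edge F p.1 p.2].
    by apply/seteqP; split => w /= h; [move=> p _|move=> i j; exact: (h (i, j) I)].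
  apply: fin_bigcap_measurable; first exact: finite_finset.
  move=> [i j] _ /=; case: (edge F i j); first exact: mE.
  rewrite (_ : [set w | _] = ~` [set w | E w i j]); first exact/measurableC/mE.
  by apply/seteqP; split => w /=; [move=> ->|move=> /negP/negbTE].
split=> [/kernel_transitiveP G0|Etr].
  (* Countably many null events, enumerated by [pickle]: the first vertices span a given
     non-transitive tournament. All other codes get [set0]. *)
  pose N k : set Om := if @unpickle {n & tournament n} k is Some F then
    (if tournament_transitive (tagged F) then set0 else ev _ (tagged F)) else set0.
  apply: (@negligibleS _ _ _ _ (\bigcup_k N k)); last first.
    apply: negligible_bigcup => k; rewrite /N; case: unpickle => [[n F]|] /=;
      last exact: negligible_set0.
    case: ifPn => Ftr; first exact: negligible_set0.
    by exists (ev n F); split => //; rewrite Pev G0.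
  (* Outside these events, any three vertices lie in an initial segment spanning a transitive
     tournament. *)
  move=> w /= ntr; apply: contrapT => nN; apply: ntr => j i k ij jk.
  pose n := (maxn i (maxn j k)).+1.
  have [F FE] : exists F : tournament n, edge F =2 (fun a b : 'I_n => E w a b).
    by apply: tournament_of_relP => a b; rewrite Etour.
  have lti : (i < n)%N by rewrite ltnS leq_maxl.
  have ltj : (j < n)%N by rewrite ltnS !leq_max leqnn orbT.
  have ltk : (k < n)%N by rewrite ltnS !leq_max leqnn !orbT.
  have [/tournament_transitiveP Ftr|Ftr] := boolP (tournament_transitive F).
    have := Ftr (Ordinal ltj) (Ordinal lti) (Ordinal ltk).
    by rewrite !FE/=; exact.
  exfalso; apply: nN; exists (pickle (Tagged (fun n => tournament n) F)) => //.
  by rewrite /N pickleK /= (negbTE Ftr) => a b; rewrite FE.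
(* Conversely, the event that the first three vertices span [C3] lies in the negligible set where
   [E w] is not transitive. *)
apply: limit_C3_kernel_transitive; apply: (@EFin_inj R); rewrite -Pev.
apply/(measure_negligible (mev _ _)); apply: negligibleS Etr => w /= h tr.
have /tournament_transitiveP := C3_not_transitive; apply => j i k.
by rewrite -!h; exact: tr.
Qed.

End represented_limit.

Theorem theorem8p6 (R : realType) (d : measure_display) (S : measurableType d)
    (mu : probability S R) (W : S * S -> R) (Gamma : tournament_limit R)
    (hW : tournament_kernel mu W) (hGamma : represents mu W Gamma) :
  [/\ (limit_transitive Gamma <-> kernel_transitive mu W),
      (forall (d' : measure_display) (Om : measurableType d')
              (P : probability Om R) (X : nat -> {RV P >-> S}) (E : Om -> rel nat),
         Ginfty_version mu W X E ->
         (kernel_transitive mu W <-> Ginfty_as_transitive P E)) &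
      (kernel_transitive mu W <->
         forall n : nat, (1 <= n)%N -> Gn_as_transitive mu W n)].
Proof.
split; first exact: limit_transitiveP hW hGamma.
  by move=> d' Om P X E; exact: Ginfty_as_transitiveP hW hGamma _ _ _ _ _.
split=> [/(kernel_transitiveP hW hGamma) G0 n _|Gn].
  by apply/(Gn_as_transitiveP hW hGamma) => F; exact: G0.
apply: (limit_C3_kernel_transitive hW hGamma).
(* The case [n = 3] gives density zero to [C3]. *)
exact: (proj1 (Gn_as_transitiveP hW hGamma 3) (Gn _ _) _ C3_not_transitive).
Qed.
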